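(* Let $X$ be an infinite compact space. Then the spaces $C_p(X)$ and $C(X)_w$ are not isomorphic.
   Context: All topological spaces are Tychonoff (completely regular and Hausdorff). $C_p(X)$ is the space of continuous real-valued functions on $X$ with the pointwise topology (inherited from $\mathbb{R}^X$). $C(X)_w$ is the Banach space $C(X)$ (supremum norm) endowed with its weak topology. Isomorphic means linearly homeomorphic. *)

(* Defs.v *)
From HB Require Import structures.
From mathcomp Require Import all_boot all_order all_algebra.
From mathcomp Require Import all_classical all_reals all_analysis.

Set Implicit Arguments.
Unset Strict Implicit.
Unset Printing Implicit Defensive.

Import Order.TTheory GRing.Theory Num.Theory.
Import numFieldNormedType.Exports.

Local Open Scope classical_set_scope.
Local Open Scope ring_scope.

(** The vector space of continuous functions X -> R, with the pointwise
    operations.  No topology is attached to [continuousType X R] itself. *)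

Section continuous_lmodule.
Context {R : realType} {X : topologicalType}.
Local Notation C := (continuousType X R).
Implicit Types (f g h : C) (a b : R).

Let ct f : continuous (f : X -> R). Proof. exact: cts_fun. Qed.

Lemma cts_add_subproof f g : continuous (fun x => f x + g x).
Proof. by move=> x; apply: cvgD; apply: ct. Qed.

Lemma cts_opp_subproof f : continuous (fun x => - f x).
Proof. by move=> x; apply: cvgN; apply: ct. Qed.

Lemma cts_scale_subproof a f : continuous (fun x => a * f x).
Proof. by move=> x; apply: cvgM; [exact: cvg_cst|apply: ct]. Qed.

Definition cts0 : C := cst (0 : R).
Definition cts_add f g : C := mkcts (@cts_add_subproof f g).
Definition cts_opp f : C := mkcts (@cts_opp_subproof f).
Definition cts_scale a f : C := mkcts (@cts_scale_subproof a f).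

Lemma cts_addA : associative cts_add.
Proof. by move=> f g h; apply/continuousEP => x; exact: addrA. Qed.

Lemma cts_addC : commutative cts_add.
Proof. by move=> f g; apply/continuousEP => x; exact: addrC. Qed.

Lemma cts_add0 : left_id cts0 cts_add.
Proof. by move=> f; apply/continuousEP => x; exact: add0r. Qed.

Lemma cts_addN : left_inverse cts0 cts_opp cts_add.
Proof. by move=> f; apply/continuousEP => x; exact: addNr. Qed.

HB.instance Definition _ :=
  GRing.isZmodule.Build C cts_addA cts_addC cts_add0 cts_addN.

Lemma cts_scaleA a b f : cts_scale a (cts_scale b f) = cts_scale (a * b) f.
Proof. by apply/continuousEP => x; exact: mulrA. Qed.

Lemma cts_scale1 : left_id 1 cts_scale.
Proof. by move=> f; apply/continuousEP => x; exact: mul1r. Qed.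

Lemma cts_scaleDr : right_distributive cts_scale +%R.
Proof. by move=> a f g; apply/continuousEP => x; exact: mulrDr. Qed.

Lemma cts_scaleDl f : {morph cts_scale^~ f : a b / a + b}.
Proof. by move=> a b; apply/continuousEP => x; exact: mulrDl. Qed.

HB.instance Definition _ := GRing.Zmodule_isLmodule.Build R C
  cts_scaleA cts_scale1 cts_scaleDr cts_scaleDl.

End continuous_lmodule.

Definition Cp (R : realType) (X : topologicalType) : Type := continuousType X R.

Section Cp_instances.
Context (R : realType) (X : topologicalType).

HB.instance Definition _ := GRing.Lmodule.copy (Cp R X) (continuousType X R).
HB.instance Definition _ := Topological.copy (Cp R X)
  (initial_topology (fun f : continuousType X R => (f : {ptws X -> R}))).

End Cp_instances.

(** The proof of compactness is a parameter of the type so that the sup norm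
    (which is finite only for bounded functions) can be a canonical
    [normedModType] structure on it. *)
Definition CBanach (R : realType) (X : topologicalType)
  (compactX : compact [set: X]) : Type := continuousType X R.

Section CBanach_instances.
Context (R : realType) (X : topologicalType) (compactX : compact [set: X]).
Local Notation C := (CBanach R compactX).

HB.instance Definition _ := GRing.Lmodule.copy C (continuousType X R).

(** When X is empty this is [sup set0], i.e. 0. *)
Definition sup_norm (f : continuousType X R) : R := sup (range (fun x => `|f x|)).

Lemma sup_norm_has_ubound (f : continuousType X R) :
  has_ubound (range (fun x => `|f x|)).
Proof.
have cf : {within [set: X], continuous f}.
  by apply: continuous_subspaceT; exact: cts_fun.
have [M [_ Mf]] := compact_bounded (continuous_compact cf compactX).
exists (M + 1) => _ [x _ <-]; apply: (Mf (M + 1)); first by rewrite ltrDl.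
by exists x.
Qed.

Lemma le_sup_norm (f : continuousType X R) x : `|f x| <= sup_norm f.
Proof. by apply: ub_le_sup; [exact: sup_norm_has_ubound|exists x]. Qed.

Lemma sup_norm_le (f : continuousType X R) (c : R) :
  0 <= c -> (forall x, `|f x| <= c) -> sup_norm f <= c.
Proof.
move=> c0 fc; rewrite /sup_norm.
have [->|/set0P ne] := eqVneq (range (fun x => `|f x|)) set0.
  by rewrite sup0.
by apply: ge_sup => // _ [x _ <-].
Qed.

Lemma sup_norm_ge0 (f : continuousType X R) : 0 <= sup_norm f.
Proof.
rewrite /sup_norm.
have [->|/set0P[_ [x _ _]]] := eqVneq (range (fun x => `|f x|)) set0.
  by rewrite sup0.
by apply: le_trans (le_sup_norm f x).
Qed.

Lemma sup_normD (f g : C) : sup_norm (f + g) <= sup_norm f + sup_norm g.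
Proof.
apply: sup_norm_le => [|x]; first by rewrite addr_ge0// sup_norm_ge0.
by rewrite (le_trans (ler_normD _ _))// lerD// le_sup_norm.
Qed.

Lemma sup_normZ (a : R) (f : C) : sup_norm (a *: f) = `|a| * sup_norm f.
Proof.
have le b (g : C) : sup_norm (b *: g) <= `|b| * sup_norm g.
  apply: sup_norm_le => [|x]; first by rewrite mulr_ge0// sup_norm_ge0.
  by rewrite normrM ler_wpM2l// le_sup_norm.
have [->|a0] := eqVneq a 0.
  apply/eqP; rewrite eq_le le/= normr0 mul0r; exact: sup_norm_ge0.
apply/eqP; rewrite eq_le le/= -ler_pdivlMl ?normr_gt0//.
by rewrite -[in leLHS](scalerK a0 f) -normfV le.
Qed.

Lemma sup_norm0_eq0 (f : C) : sup_norm f = 0 -> f = 0.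
Proof.
move=> f0; apply/continuousEP => x; apply/eqP.
by rewrite -normr_le0 -[leRHS]f0 le_sup_norm.
Qed.

HB.instance Definition _ :=
  Lmodule_isNormed.Build R C sup_normD sup_normZ sup_norm0_eq0.

End CBanach_instances.

(** The topological dual; the scalar field carries its usual topology. *)
Definition continuous_dual (R : realType) (E : normedModType R) : Type :=
  {phi : {linear E -> R^o} | continuous phi}.

Definition weak_space (R : realType) (E : normedModType R) : Type := E.

Section weak_instances.
Context (R : realType) (E : normedModType R).

HB.instance Definition _ := GRing.Lmodule.copy (weak_space E) E.
HB.instance Definition _ := Topological.copy (weak_space E)
  (sup_topology (fun phi : continuous_dual E =>
     Topological.class (initial_topology (sval phi : E -> R^o)))).

End weak_instances.

Definition linearly_homeomorphic (R : realType)
    (E F : preTopologicalLmodType R) : Prop :=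
  exists (T : {linear E -> F}) (S : F -> E),
    [/\ cancel T S, cancel S T, continuous T & continuous S].

(* Main.v *)
Require Import Defs.
From HB Require Import structures.
From mathcomp Require Import all_boot all_order all_algebra.
From mathcomp Require Import all_classical all_reals all_analysis.
Import Order.TTheory GRing.Theory Num.Theory.
Import numFieldNormedType.Exports.
Local Open Scope classical_set_scope.
Local Open Scope ring_scope.

(** The two spaces have different duals.  A continuous functional on Cp(X) is
    small on the functions vanishing on some finite subset of X, whereas the
    dual of C(X) contains measures such as a sum of c_n delta_(x_n) with all
    c_n > 0 and distinct points x_n, which no finite subset of X controls.

    Let T be a linear homeomorphism from Cp(X) onto the weak space of C(X),
    with inverse S.  Each g |-> (S g)(x_n) is weakly continuous, hence bounded,
    with a norm K_n that may grow with n.  Letting the coefficients depend on S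
    spares any uniform bound on S: for c_n = 2^-(n+1) / K_n the series
    phi(g) = sum_n c_n (S g)(x_n) is dominated by a geometric one and defines
    a bounded functional on C(X) ([summable_functional]).  Such a functional is
    weakly continuous, so phi \o T is continuous on Cp(X), and
    phi (T f) = sum_n c_n f(x_n).

    The functions vanishing on larger and larger finite sets converge to 0 in
    Cp(X) ([vanishing_filter_cvg]), so some finite A satisfies
    |phi (T f)| < 1 for every f vanishing on A.  Pick x_n outside A and, by
    Urysohn's lemma ([bump_function]), a nonnegative f vanishing on A with
    f(x_n) = 1 / c_n; the n-th term alone gives phi (T f) >= 1. *)

Lemma continuous_dual_weak (R : realType) (E : normedModType R)
  (phi : {linear E -> R^o}) :
  continuous phi -> continuous (phi : weak_space E -> R^o).
Proof.
move=> cphi f; have /cvg_sup/(_ (exist _ phi cphi)) h : f --> f by apply: cvg_id.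
apply: cvg_trans (@initial_continuous E R^o phi f).
by apply: cvg_app; exact: h.
Qed.

Lemma norm_to_weak_continuous (R : realType) (E : normedModType R) :
  continuous (id : E -> weak_space E).
Proof.
move=> f; apply/cvg_sup => phi U [?/= [[W oW <-]]] /= Wf /filterS; apply.
by apply: (svalP phi f W); exact: open_nbhs_nbhs.
Qed.

Lemma Cp_cvgP (R : realType) (X : topologicalType) (F : set_system (Cp R X))
  (f : Cp R X) : Filter F ->
  F --> f <->
  forall x, (fun g : Cp R X => (g : X -> R) x) @ F --> (f : X -> R) x.
Proof.
move=> FF; split=> [Ff x|Ff].
  have Fptws :
      {ptws, (fun g : Cp R X => (g : X -> R)) @ F --> (f : X -> R)}.
    apply: (cvg_trans (cvg_app _ Ff)).
    exact: (@initial_continuous (continuousType X R) {ptws X -> R}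
      (fun g => (g : X -> R)) f).
  by have /pointwise_cvgP/(_ x) := Fptws.
have /pointwise_cvgP h : forall x, (fun g : X -> R => g x) @
    ((fun g : Cp R X => (g : X -> R)) @ F) --> (f : X -> R) x by exact: Ff.
move=> U [?/= [[W oW <-]]] /= Wf /filterS; apply.
by apply: h; exact: open_nbhs_nbhs.
Qed.

(** Replaces the basic neighbourhoods of 0 in the pointwise topology: dropping
    the tolerance epsilon keeps only a finite set as index, and convergence of
    this filter to 0 is all that is needed to see that a continuous functional
    on Cp(X) is controlled by finitely many points. *)
Definition vanishing_filter (R : realType) (X : topologicalType) :
    set_system (Cp R X) :=
  filter_from [set A : set X | finite_set A]
    (fun A => [set f : Cp R X | forall x, A x -> (f : X -> R) x = 0]).

Lemma vanishing_filter_filter (R : realType) (X : topologicalType) :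
  Filter (vanishing_filter R X).
Proof.
apply: filter_from_filter => [|A B finA finB].
  by exists set0; exact: finite_set0.
exists (A `|` B); first by rewrite /= finite_setU.
by move=> f fAB; split=> x ?; apply: fAB; [left|right].
Qed.

Lemma vanishing_filter_cvg (R : realType) (X : topologicalType) :
  vanishing_filter R X --> (0 : Cp R X).
Proof.
have FF := vanishing_filter_filter R X.
apply/Cp_cvgP => x U /nbhs_singleton U0.
by exists [set x] => //= f /(_ x erefl) fx; rewrite /= fx.
Qed.

(** Countably many bounded functionals always have a convergent combination
    with positive coefficients: it suffices that the coefficients decrease fast
    enough to absorb the norms of the functionals. *)
Lemma summable_functional (R : realType) (E : normedModType R)
    (l : nat -> {linear E -> R^o}) :
  (forall n, continuous (l n)) ->
  exists c : nat -> R, (forall n, 0 < c n) /\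
    exists2 phi : {linear E -> R^o}, continuous phi &
      forall g, series (fun n => c n * l n g) @ \oo --> (phi g : R).
Proof.
move=> cl.
have /choice[K /all_and2[K0 lK]] n :
    exists K : R, 0 < K /\ forall g, `|l n g| <= K * `|g|.
  have /linear_bounded_continuous/linear_boundedP := cl n.
  move=> /pinfty_ex_gt0[K K0 lK].
  by exists K.
pose c n := (K n)^-1 / (2 ^ (n + 1))%:R.
have c0 n : 0 < c n by rewrite divr_gt0 ?invr_gt0// ltr0n expn_gt0.
pose u g n : R := c n * l n g.
have ule g n : `|u g n| <= `|g| / (2 ^ (n + 1))%:R.
  rewrite normrM (gtr0_norm (c0 n)) mulrAC ler_pM2r ?invr_gt0 ?ltr0n ?expn_gt0//.
  by rewrite ler_pdivrMl.
have geo (g : E) := @cvg_geometric_series_half R `|g| 0.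
have ncvg g : cvgn [normed series (u g)].
  by apply: (series_le_cvg _ _ (ule g)) => //; exact: cvgP (geo g).
have ucvg g : cvgn (series (u g)) by exact: normed_cvg.
pose phi (g : E) : R^o := limn (series (u g)).
have phi_lin : linear phi.
  move=> a f g; rewrite /phi -lim_seriesZ// -lim_seriesD//; last first.
    exact: is_cvg_seriesZ.
  congr (limn (series _)); apply/funext => n.
  by rewrite /u linearP/= mulrDr/= mulrCA.
pose Phi : {linear E -> R^o} :=
  HB.pack phi (GRing.isLinear.Build _ _ _ _ phi phi_lin).
exists c; split=> //; exists Phi => [|g]; last exact: ucvg.
(* The terms |g| / 2^(n+1) add up to |g|, so phi has norm at most 1. *)
apply: bounded_linear_continuous; apply/linear_boundedP.
near=> r => g; apply: le_trans (_ : `|g| <= _).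
  rewrite (le_trans (lim_series_norm (ncvg g)))//.
  have -> : `|g| = limn (series (fun k => `|g| / (2 ^ (k + 1))%:R)).
    by rewrite (cvg_lim _ (geo g))// expr0 divr1.
  exact: (lim_series_le (ncvg g) (cvgP _ (geo g)) (ule g)).
by rewrite ler_peMl.
Unshelve. all: by end_near. Qed.

Lemma bump_function (R : realType) (X : topologicalType) (A : set X) (x : X) :
  compact [set: X] -> hausdorff_space X -> finite_set A -> ~ A x ->
  exists f : Cp R X, [/\ forall y, 0 <= (f : X -> R) y, (f : X -> R) x = 1
    & forall y, A y -> (f : X -> R) y = 0].
Proof.
move=> cX hX finA Ax.
have clA : closed A.
  exact: (accessible_finite_set_closed.1 (hausdorff_accessible hX)).
have /(@normal_separatorP R) sepX : normal_space X by exact: compact_normal.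
have /(@uniform_separatorP X R)[f [cf f01 fA fx]] : uniform_separator A [set x].
  apply: sepX => //.
    exact: (accessible_closed_set1 (hausdorff_accessible hX)).
  by apply/disjoints_subset => y Ay yx; apply: Ax; rewrite -yx.
exists (mkcts cf); split=> [y||y Ay]; last by apply: fA; exists y.
- by have /f01/= : range f (f y) by []; rewrite in_itv/= => /andP[].
- by apply: fx; exists x.
Qed.

Theorem corollary7p5 (R : realType) (X : topologicalType)
  (compactX : compact [set: X]) (hausdorffX : hausdorff_space X)
  (infiniteX : infinite_set [set: X]) :
  ~ linearly_homeomorphic (Cp R X) (weak_space (CBanach R compactX)).
Proof.
move=> [T [S [TK SK cT cS]]].
have [x xinj] : exists x : nat -> X, injective x.
  have /card_leP[f] := (@infiniteP _ [set: X]).1 infiniteX.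
  exists (fun n => val (f (to_setT n))) => m n /val_inj.
  by move/(inj (in_setT _) (in_setT _))/(congr1 val).
pose E := CBanach R compactX.
have [l lE] : exists l : nat -> {linear E -> R^o},
    forall n, l n = (fun g : E => (S g : X -> R) (x n)) :> (E -> R).
  have l_lin n : linear (fun g : E => (S g : X -> R) (x n) : R^o).
    move=> a f g; have -> : S (a *: f + g) = a *: S f + S g; last by [].
    by apply: (can_inj TK); rewrite linearP/= !SK.
  by exists (fun n => HB.pack_for {linear E -> R^o}
    (fun g : E => (S g : X -> R) (x n) : R^o)
    (GRing.isLinear.Build _ _ _ _ _ (l_lin n))).
have cl n : continuous (l n).
  move=> g; have cSg : S @ nbhs (g : E) --> (S g : Cp R X).
    exact: cvg_trans (cvg_app S (@norm_to_weak_continuous R E g)) (cS g).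
  rewrite /continuous_at lE; exact: (Cp_cvgP _ _ _ _ _).1 cSg (x n).
have [c [c0 [phi cphi phiE]]] := summable_functional _ _ l cl.
have : (phi \o T) @ vanishing_filter R X --> (0 : R^o).
  have FF := vanishing_filter_filter R X.
  have T0 : T @ vanishing_filter R X --> (0 : weak_space E).
    rewrite -(linear0 T); apply: cvg_trans (cT 0).
    by apply: cvg_app; exact: vanishing_filter_cvg.
  rewrite -(linear0 phi); apply: cvg_trans (continuous_dual_weak _ _ _ cphi 0).
  exact: (cvg_app _ T0).
move=> /(_ (ball (0 : R) 1) (nbhsx_ballx _ _ ltr01)) [A finA vanA].
have [n Axn] : exists n, ~ A (x n).
  apply: contrapT => /forallNP/(_ _)/contrapT => xA.
  apply: infinite_nat.
  have := finite_preimage (in2W xinj) finA.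
  by congr finite_set; apply/seteqP; split=> // k _; exact: xA.
have [f [f0 fx fA]] := bump_function R X A (x n) compactX hausdorffX finA Axn.
(* The multiple of f by 1 / c n makes the n-th term of the series equal to 1. *)
have /vanA : forall y, A y -> (((c n)^-1 *: f : Cp R X) : X -> R) y = 0.
  by move=> y /fA fy; rewrite -[LHS]/((c n)^-1 * (f : X -> R) y) fy mulr0.
rewrite /= -ball_normE/= sub0r normrN => phi1.
have := phiE (T ((c n)^-1 *: f)).
set u := series _ => uphi.
suff : 1 <= phi (T ((c n)^-1 *: f)).
  by move/(le_lt_trans (ler_norm _)): phi1 => /lt_geF->.
have lTE k : l k (T ((c n)^-1 *: f)) = (c n)^-1 * (f : X -> R) (x k).
  by rewrite lE TK.
rewrite -(cvg_lim _ uphi)//; apply: limr_ge; first exact: cvgP uphi.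
near=> m; rewrite /u /series /=.
have nm : (n < m)%N by near: m; exact: nbhs_infty_gt.
rewrite big_mkord (bigD1 (Ordinal nm))//= lTE fx mulr1 divff ?gt_eqF//.
rewrite lerDl sumr_ge0// => k _; rewrite lTE !mulr_ge0 ?invr_ge0 ?f0 ?(ltW (c0 _)).
Unshelve. all: by end_near. Qed.
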